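(* For every positive integer $r$, \[ \sum_{n=1}^\infty \frac{\binom{2n}{n}}{n4^n}\zeta_n^\star(\{2\}_r)=2(1-4^{-r})\zeta(2r+1). \]
   Context: For a positive integer $n$ and a tuple $(k_1,\ldots,k_r)$ of positive integers, the multiple harmonic star sum is $\zeta^\star_n(k_1,\ldots,k_r):=\sum_{n\ge n_1\ge\cdots\ge n_r>0}\frac{1}{n_1^{k_1}\cdots n_r^{k_r}}$. The notation $\{2\}_r$ denotes the sequence $2,2,\ldots,2$ with $r$ repetitions. $\zeta$ is the Riemann zeta function. *)

(* Defs.v *)
From mathcomp Require Import all_boot all_order all_algebra.
From mathcomp Require Import all_classical all_reals all_analysis.
Set Implicit Arguments.
Unset Strict Implicit.
Unset Printing Implicit Defensive.
Import Order.TTheory GRing.Theory Num.Theory.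
Import numFieldNormedType.Exports.
Local Open Scope classical_set_scope.
Local Open Scope ring_scope.

(* The tuple m = (n_1, ..., n_r) ranges over the integers 0, ..., n, restricted
   to n_1 >= ... >= n_r with every n_i positive. *)
Definition zeta_star (R : realType) (r n : nat) (k : r.-tuple nat) : R :=
  \sum_(m : r.-tuple 'I_n.+1 |
          sorted geq (map val m) && all (fun i : 'I_n.+1 => (0 < i)%N) m)
    \prod_(i < r) ((tnth m i)%:R ^+ tnth k i)^-1.

(* Dirichlet series sum_{n >= 1} n^{-s}; it represents the Riemann zeta function
   for real s > 1 only. *)
Definition riemann_zeta (R : realType) (s : R) : R :=
  limn (series (riemannR s)).

(* Main.v *)
Require Import Defs.
From mathcomp Require Import all_boot all_order all_algebra.
From mathcomp Require Import all_classical all_reals all_analysis.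
From mathcomp Require Import ring lra zify.
Import Order.TTheory GRing.Theory Num.Theory.
Import numFieldNormedType.Exports.
Local Open Scope classical_set_scope.
Local Open Scope ring_scope.

(** With [b_n(k) = C(2n, n + k) / 4^n], the partial fraction expansion of
    [prod_(k <= n) (1 - x^2/k^2)^-1] gives
      [b_n(0) zeta*_n({2}_r) = 2 sum_(k = 1)^n (-1)^(k-1) b_n(k) / k^(2r)].
    Exchanging the sums over [n <= N] and [k], one needs
    [sum_(n <= N) b_n(k) / n], which is [1/k] times the probability that a simple
    random walk reaches [2k] within [2N] steps.  By the reflection principle the
    complementary probability is a sum of [2k] values of [b_N], hence at most
    [2k b_N(0)].  As [sum_k k^(-2r) <= 2] for [r >= 1] and [b_N(0) -> 0], the
    partial sums have the same limit as [2 sum_(k <= N) (-1)^(k-1) / k^(2r+1)]. *)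

Section StarSum.
Variable R : realType.

(** * Star sums of twos as a recursion on the depth *)

Fixpoint star2 (r n : nat) : R :=
  if r is r'.+1 then \sum_(i < n) (i.+1%:R ^+ 2)^-1 * star2 r' i.+1 else 1.

Lemma star2S r n :
  star2 r.+1 n.+1 = star2 r.+1 n + (n.+1%:R ^+ 2)^-1 * star2 r n.+1.
Proof. by rewrite /= big_ord_recr. Qed.

Lemma big_tuple_cons (T : finType) (r : nat) (P : pred (seq T)) (F : seq T -> R) :
  \sum_(t : r.+1.-tuple T | P t) F t =
  \sum_(x : T) \sum_(t : r.-tuple T | P (x :: t)) F (x :: t).
Proof.
rewrite pair_big_dep/=.
rewrite (reindex (fun p : T * r.-tuple T => cons_tuple p.1 p.2))//=.
exists (fun t => (thead t, [tuple of behead t])) => [[x t] _|t _] /=.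
  by rewrite theadE; congr pair; apply/val_inj.
by rewrite [RHS]tuple_eta; apply/val_inj.
Qed.

(** The bound [b] is kept apart from the type bound [M]: removing the head [x] leaves the same sum
    with [b] replaced by [x] over the same finite type, so induction on [r] applies. *)
Lemma star2_tuples (M r b : nat) : (b <= M)%N ->
  \sum_(t : r.-tuple 'I_M.+1 |
      path geq b (map val t) && all (fun i : 'I_M.+1 => (0 < i)%N) t)
    \prod_(i <- t) ((i : nat)%:R ^+ 2)^-1 = star2 r b.
Proof.
elim: r b => [|r IH] b bM.
  rewrite (big_pred1 [tuple]) => [|t]; first exact: big_nil.
  by rewrite [t]tuple0; apply/esym/eqP.
rewrite (@big_tuple_cons _ r
  (fun t => path geq b (map val t) && all (fun i : 'I_M.+1 => (0 < i)%N) t)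
  (fun t => \prod_(i <- t) ((i : nat)%:R ^+ 2)^-1))/=.
transitivity (\sum_(x < M.+1 | (0 < x <= b)%N)
    ((x : nat)%:R ^+ 2)^-1 * star2 r x).
  rewrite [RHS]big_mkcond/=; apply: eq_bigr => x _.
  case: ifPn => [/andP[x0 xb]|nx].
    rewrite -(IH x) ?(leq_trans xb)// big_distrr/=.
    by apply: eq_big => [t|t _]; [rewrite /= x0|rewrite big_cons].
  rewrite big_pred0// => t; apply/negbTE; apply: contra nx.
  by move=> /andP[/andP[-> _] /andP[-> _]].
rewrite -(big_mkord (fun i => (0 < i <= b)%N) (fun i => (i%:R ^+ 2)^-1 * star2 r i)).
rewrite big_mkcond big_nat_recl//= add0r -big_mkcond/=.
rewrite -(big_mkord xpredT (fun i => (i.+1%:R ^+ 2)^-1 * star2 r i.+1)).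
rewrite [RHS](big_nat_widen _ _ _ _ _ bM).
exact: eq_bigl.
Qed.

Lemma zeta_star_star2 (r n : nat) : zeta_star R n (nseq_tuple r 2%N) = star2 r n.
Proof.
rewrite -(@star2_tuples n r n)// /zeta_star.
apply: eq_big => [t|t _].
  congr (_ && _); rewrite path_min_sorted// all_map; apply/allP => i _ /=.
  by rewrite /geq/= -ltnS.
rewrite [RHS]big_tuple; apply: eq_bigr => i _.
by rewrite [tnth (nseq_tuple _ _) _](tnth_nth 0%N)/= nth_nseq ltn_ord.
Qed.

(** * Normalised binomial coefficients around the centre *)

Definition cbin (n k : nat) : R := 'C(2 * n, n + k)%:R / 4 ^+ n.

Lemma cbin_ge0 n k : 0 <= cbin n k.
Proof. by rewrite divr_ge0// exprn_ge0. Qed.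

Lemma cbin_gt n k : (n < k)%N -> cbin n k = 0.
Proof. by move=> nk; rewrite /cbin bin_small ?mul0r//; lia. Qed.

Lemma cbinSr n k : cbin n k.+1 = (n%:R - k%:R) / (n%:R + k%:R + 1) * cbin n k.
Proof.
have [nk|kn] := ltnP n k; first by rewrite !cbin_gt ?mulr0// ltnW.
have := mul_bin_left (2 * n) (n + k).
rewrite (_ : (2 * n - (n + k) = n - k)%N); last by lia.
move/(congr1 (fun m => m%:R : R)); rewrite !natrM natrB// -natr1 natrD => e.
have e4 : (4 ^+ n : R) != 0 by rewrite expf_neq0.
have e1 : n%:R + k%:R + 1 != 0 :> R by rewrite -natrD natr1.
rewrite /cbin [in LHS](_ : _%:R = (n%:R - k%:R) * 'C(2 * n, n + k)%:R / (n%:R + k%:R + 1)).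
  by field; rewrite e4 e1.
by rewrite -e addnS; field.
Qed.

(** Pascal's rule applied twice: two steps of the walk move it by -2, 0 or 2 with weights 1/4, 1/2,
    1/4. *)
Lemma cbinS n k :
  cbin n.+1 k.+1 = (cbin n k + 2 * cbin n k.+1 + cbin n k.+2) / 4.
Proof.
rewrite /cbin exprS (_ : (2 * n.+1 = (2 * n).+2)%N); last by lia.
rewrite addSn !addnS !binS !natrD.
have e4 : (4 ^+ n : R) != 0 by rewrite expf_neq0.
by field.
Qed.

(** Kept free of division so that it covers [k = n.+1], where both sides vanish. *)
Lemma cbin_mulS n k :
  cbin n.+1 k * ((n.+1%:R - k%:R) * (n.+1%:R + k%:R)) =
  cbin n k * n.+1%:R * (n%:R + 2^-1).
Proof.
have [nk|] := ltnP n.+1 k; first by rewrite !cbin_gt ?mul0r//; lia.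
rewrite leq_eqVlt => /orP[/eqP->|kn].
  by rewrite (@cbin_gt n) ?mul0r ?subrr ?mul0r ?mulr0.
have := mul_bin_diag (2 * n).+2 (n + k).
have /= := mul_bin_down (2 * n).+1 (n + k).
rewrite (_ : ((2 * n).+1 - (n + k) = n.+1 - k)%N); last by lia.
move=> /(congr1 (fun m => m%:R : R)); rewrite !natrM natrB; last by lia.
move=> e1 /(congr1 (fun m => m%:R : R)); rewrite /= !natrM => e2.
have e4 : (4 ^+ n : R) != 0 by rewrite expf_neq0.
have : (2 * n).+2%:R * (2 * n).+1%:R * 'C(2 * n, n + k)%:R =
  'C((2 * n).+2, (n + k).+1)%:R * ((n.+1%:R - k%:R) * (n + k).+1%:R) :> R.
  by rewrite -mulrA e1 mulrCA e2; ring.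
rewrite /cbin exprS (_ : (2 * n.+1 = (2 * n).+2)%N); last by lia.
have -> : (2 * n).+2%:R = 2 * n%:R + 2 :> R by rewrite -!natr1 natrM; ring.
have -> : (2 * n).+1%:R = 2 * n%:R + 1 :> R by rewrite -natr1 natrM.
rewrite addSn -[n.+1%:R]natr1 -[(n + k).+1%:R]natr1 natrD => e3.
rewrite (_ : n%:R + 1 + k%:R = n%:R + k%:R + 1 :> R); last by ring.
by rewrite [LHS]mulrAC -e3; field.
Qed.

Lemma cbin0S n : cbin n.+1 0 = (n%:R + 2^-1) / n.+1%:R * cbin n 0.
Proof.
have := cbin_mulS n 0; rewrite subr0 addr0 => e.
have n0 : n.+1%:R != 0 :> R by [].
apply: (mulIf (mulf_neq0 n0 n0)); rewrite e.
by field; rewrite addrC natr1.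
Qed.

Lemma cbin_le0 n k : cbin n k <= cbin n 0.
Proof.
elim: k => // k /(le_trans _); apply; rewrite cbinSr ler_piMl ?cbin_ge0//.
rewrite ler_pdivrMr; last by rewrite -natrD natr1.
by rewrite mul1r -addrA lerD2l -subr_ge0 opprK !addr_ge0.
Qed.

Lemma cbin0_sqr_le n : cbin n 0 ^+ 2 <= n.+1%:R^-1.
Proof.
suff : cbin n 0 ^+ 2 <= (2 * n%:R + 1)^-1.
  have h : 0 <= n%:R :> R by [].
  by move=> /le_trans; apply; rewrite -natr1 lef_pV2 ?posrE; lra.
elim: n => [|n IH]; first by rewrite /cbin bin0 divr1 mulr0 add0r invr1 expr1n.
have h : 0 <= n%:R :> R by [].
rewrite cbin0S exprMn (le_trans (ler_wpM2l (sqr_ge0 _) IH))// -[n.+1%:R]natr1.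
rewrite -subr_ge0.
(* The gap is explicit because [(2n+2)^2 - (2n+1)(2n+3) = 1]. *)
have -> : (2 * (n%:R + 1) + 1)^-1 -
    ((n%:R + 2^-1) / (n%:R + 1)) ^+ 2 * (2 * n%:R + 1)^-1 =
    ((4 * (2 * n%:R + 3)) * (n%:R + 1) ^+ 2)^-1 :> R.
  by field; rewrite !lt0r_neq0//; lra.
by rewrite invr_ge0 mulr_ge0 ?sqr_ge0//; lra.
Qed.

Lemma cbin0_cvg0 : cbin n 0 @[n --> \oo] --> 0.
Proof.
have h : cbin n 0 ^+ 2 @[n --> \oo] --> 0.
  apply: (squeeze_cvgr _ (cvg_cst 0) cvg_harmonic).
  by near=> n; rewrite sqr_ge0/= cbin0_sqr_le.
have : Num.sqrt (cbin n 0 ^+ 2) @[n --> \oo] --> Num.sqrt (0 : R).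
  by apply: continuous_cvg h; exact: sqrt_continuous.
rewrite sqrtr0; under eq_fun do rewrite sqrtr_sqr ger0_norm ?cbin_ge0//.
exact.
Unshelve. all: by end_near. Qed.

(** * Partial fraction expansion of the star sum *)

(** The ratio [cbinSr] makes the alternating sum telescope. At [m = n.+1] the last term vanishes,
    which gives the case [r = 0] of the expansion. *)
Lemma cbin_alternating n m :
  \sum_(k < m) (-1) ^+ k * cbin n.+1 k.+1 =
  2^-1 * (cbin n.+1 0 - (-1) ^+ m * (1 - m%:R / n.+1%:R) * cbin n.+1 m).
Proof.
elim: m => [|m IH]; first by rewrite big_ord0; ring.
rewrite big_ord_recr/= IH cbinSr exprS -[m.+1%:R]natr1 -[n.+1%:R]natr1.
have n0 : 0 <= n%:R :> R by [].
have m0 : 0 <= m%:R :> R by [].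
by field; rewrite !lt0r_neq0//; lra.
Qed.

(* Induction on [r], then [n]: both sides satisfy the recurrence [star2S], as
   [b_(n+1)(k) - (b_(n+1)(0) / b_n(0)) b_n(k) = b_(n+1)(k) k^2 / (n+1)^2]. *)
Lemma cbin_star2 r n : (0 < n)%N || (0 < r)%N ->
  cbin n 0 * star2 r n =
  2 * \sum_(k < n) (-1) ^+ k * cbin n k.+1 / k.+1%:R ^+ (2 * r).
Proof.
elim: r n => [|r IHr] n.
  case: n => // n _; rewrite mulr1.
  under eq_bigr do rewrite muln0 expr0 divr1.
  rewrite cbin_alternating divff ?subrr//.
  by field.
move=> _; elim: n => [|n IHn]; first by rewrite /= !big_ord0 !mulr0.
rewrite star2S mulrDr {1}cbin0S -[_ * cbin n 0 * _]mulrA IHn [cbin n.+1 0 * (_ * _)]mulrCA IHr//.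
(* The added term is 0 since [cbin n n.+1 = 0]; the sums can then be compared term by term. *)
have -> : \sum_(k < n) (-1) ^+ k * cbin n k.+1 / k.+1%:R ^+ (2 * r.+1) =
          \sum_(k < n.+1) (-1) ^+ k * cbin n k.+1 / k.+1%:R ^+ (2 * r.+1).
  by rewrite big_ord_recr/= (@cbin_gt n n.+1)// mulr0 mul0r addr0.
rewrite !(mulrCA _ 2) -mulrDr; congr (_ * _).
rewrite !big_distrr -big_split/=; apply: eq_bigr => k _.
rewrite mulnS exprD.
have n0 : n.+1%:R != 0 :> R by [].
have k0 : k.+1%:R != 0 :> R by [].
have -> : (n%:R + 2^-1) / n.+1%:R *
  ((-1) ^+ k * cbin n k.+1 / (k.+1%:R ^+ 2 * k.+1%:R ^+ (2 * r))) =
  (cbin n k.+1 * n.+1%:R * (n%:R + 2^-1)) * ((-1) ^+ k /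
   (n.+1%:R ^+ 2 * (k.+1%:R ^+ 2 * k.+1%:R ^+ (2 * r)))) :> R.
  move: (n.+1%:R : R) (k.+1%:R : R) n0 k0 => x y n0 k0.
  by field; rewrite n0 k0 expf_neq0.
rewrite -cbin_mulS.
move: (n.+1%:R : R) (k.+1%:R : R) n0 k0 => x y n0 k0.
by field; rewrite n0 k0 expf_neq0.
Qed.

(** * Reflection principle for the random walk *)

(* [window n k] is the mass of the positions [-k, ..., k + 1]: the probability
   that the walk of length [2n] stays below [2(k + 1)]. *)
Definition window (n k : nat) : R := \sum_(j < k.+1) (cbin n j + cbin n j.+1).

Lemma window_ge0 n k : 0 <= window n k.
Proof. by apply: sumr_ge0 => j _; rewrite addr_ge0 ?cbin_ge0. Qed.

Lemma window_le n k : window n k <= 2 * k.+1%:R * cbin n 0.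
Proof.
apply: (@le_trans _ _ (\sum_(j < k.+1) (cbin n 0 + cbin n 0))).
  by apply: ler_sum => j _; rewrite lerD ?cbin_le0.
rewrite sumr_const card_ord -[leLHS]mulr_natl.
by rewrite (_ : _ * (_ + _) = 2 * k.+1%:R * cbin n 0)//; ring.
Qed.

Lemma window0 k : window 0 k = 1.
Proof.
rewrite /window big_ord_recl big1 => [|j _]; last by rewrite !cbin_gt ?addr0.
by rewrite /= [cbin 0 1]cbin_gt// !addr0 /cbin bin0 divr1.
Qed.

(** The mass lost is the probability that the walk first reaches [2(k+1)] at time [2(n+1)], as given
    by the hitting time theorem. *)
Lemma windowS n k :
  window n.+1 k = window n k - k.+1%:R / n.+1%:R * cbin n.+1 k.+1.
Proof.
have n0 : 0 <= n%:R :> R by [].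
elim: k => [|k IH].
  rewrite /window !big_ord1/= cbin0S cbinS !cbinSr -!natr1.
  by field; rewrite !lt0r_neq0//; lra.
rewrite /window big_ord_recr/= -/(window n.+1 k) IH [in RHS]big_ord_recr/= -/(window n k).
rewrite !cbinS !cbinSr -!natr1.
have k0 : 0 <= k%:R :> R by [].
by field; rewrite !lt0r_neq0//; lra.
Qed.

(** By [windowS] the sum telescopes, starting from [window 0 k = 1]. *)
Lemma sum_cbin N k :
  \sum_(n < N) cbin n.+1 k.+1 / n.+1%:R = (1 - window N k) / k.+1%:R.
Proof.
elim: N => [|N IH]; first by rewrite big_ord0 window0 subrr mul0r.
rewrite big_ord_recr/= IH windowS.
have n0 : N.+1%:R != 0 :> R by [].
have k0 : k.+1%:R != 0 :> R by [].
by move: (N.+1%:R : R) (k.+1%:R : R) n0 k0 => x y n0 k0; field; rewrite n0 k0.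
Qed.

(** * Exchange of the sums and error bound *)

Lemma sum_star2 r N : (0 < r)%N ->
  \sum_(n < N) cbin n.+1 0 / n.+1%:R * star2 r n.+1 =
  2 * \sum_(k < N) (-1) ^+ k / k.+1%:R ^+ (2 * r + 1) * (1 - window N k).
Proof.
move=> r0.
transitivity (\sum_(n < N) \sum_(k < N)
  2 * ((-1) ^+ k / k.+1%:R ^+ (2 * r) * (cbin n.+1 k.+1 / n.+1%:R))).
  apply: eq_bigr => n _; rewrite mulrAC cbin_star2// -big_distrr/= -mulrA.
  congr (_ * _); rewrite big_distrl/=.
  (* The range of [k] is made independent of [n]; the new terms vanish by [cbin_gt]. *)
  rewrite (big_ord_widen N (fun k => (-1) ^+ k * cbin n.+1 k.+1 / k.+1%:R ^+ (2 * r) / n.+1%:R))//.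
  rewrite big_mkcond/=; apply: eq_bigr => k _; case: ifPn => [_|].
    by rewrite -[in LHS]mulrA [_^-1 * _]mulrC; ring.
  by rewrite -leqNgt => nk; rewrite cbin_gt// mul0r mulr0.
rewrite exchange_big big_distrr/=; apply: eq_bigr => k _.
rewrite -!big_distrr/= sum_cbin exprD expr1 invfM; congr (_ * _).
by rewrite -!mulrA; congr (_ * (_ * _)); rewrite mulrC.
Qed.

Lemma sum_inv_sqr_le N : \sum_(k < N) (k.+1%:R ^+ 2)^-1 <= 2 :> R.
Proof.
case: N => [|N]; first by rewrite big_ord0.
(* Strengthened for induction, using [1/(m+1)^2 <= 1/m - 1/(m+1)]. *)
suff : \sum_(k < N.+1) (k.+1%:R ^+ 2)^-1 <= 2 - N.+1%:R^-1 :> R.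
  by move=> /le_trans; apply; rewrite gerBl.
elim: N => [|N IH]; first by rewrite big_ord1 expr1n invr1; lra.
rewrite big_ord_recr/= -!natr1.
rewrite -!natr1 in IH.
have N0 : 0 <= N%:R :> R by [].
rewrite (le_trans (lerD IH (lexx _)))// -subr_ge0.
rewrite [leRHS](_ : _ = ((N%:R + 1) * (N%:R + 1 + 1) ^+ 2)^-1).
  by rewrite invr_ge0 mulr_ge0 ?sqr_ge0//; lra.
by field; rewrite !lt0r_neq0//; lra.
Qed.

Lemma inv_pow_le k s t :
  (s <= t)%N -> (k.+1%:R ^+ t)^-1 <= (k.+1%:R ^+ s)^-1 :> R.
Proof.
move=> st; rewrite lef_pV2 ?posrE ?exprn_gt0//.
by rewrite ler_weXn2l// ler1n.
Qed.

(** The 8 is the outer 2, times the 2 of [window_le], times the bound 2 on the sum of inverse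
    squares. The factor [k.+1] of [window_le] lowers the exponent to [2 * r], which is still at
    least 2. *)
Lemma sum_star2_eta r N : (0 < r)%N ->
  `|\sum_(n < N) cbin n.+1 0 / n.+1%:R * star2 r n.+1
    - 2 * \sum_(k < N) (-1) ^+ k / k.+1%:R ^+ (2 * r + 1)| <= 8 * cbin N 0.
Proof.
move=> r0; rewrite sum_star2// -mulrBr -sumrB normrM ger0_norm//.
have -> : 8 * cbin N 0 = 2 * (2 * cbin N 0 * 2) by ring.
rewrite ler_pM2l// (le_trans (ler_norm_sum _ _ _))//.
apply: (@le_trans _ _ (2 * cbin N 0 * \sum_(k < N) (k.+1%:R ^+ 2)^-1)); last first.
  by rewrite ler_wpM2l ?mulr_ge0 ?cbin_ge0// sum_inv_sqr_le.
rewrite big_distrr/=; apply: ler_sum => k _.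
rewrite mulrBr mulr1 addrAC subrr sub0r normrN normrM normrM normrX normrN1 expr1n mul1r.
have k0 : 0 <= (k.+1%:R ^+ (2 * r + 1))^-1 :> R by rewrite invr_ge0 exprn_ge0.
rewrite !ger0_norm ?window_ge0//.
rewrite (le_trans (ler_wpM2l k0 (window_le N k)))//.
rewrite (_ : _^-1 * _ = 2 * cbin N 0 * (k.+1%:R ^+ (2 * r))^-1); last first.
  rewrite exprD expr1.
  have kn0 : k.+1%:R != 0 :> R by [].
  by move: (k.+1%:R : R) kn0 => x kn0; field; rewrite kn0 expf_neq0.
by rewrite ler_wpM2l ?mulr_ge0 ?cbin_ge0// inv_pow_le// leq_pmulr.
Qed.

(** * From the alternating series to zeta *)

(** Subtracting the even-denominator terms twice gives the signs, and [2 / 2^(2r+1) = 4^-r]. There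
    are [N %/ 2] such terms. *)
Lemma eta_partial r N :
  \sum_(k < N) (-1) ^+ k / k.+1%:R ^+ (2 * r + 1) =
  \sum_(k < N) (k.+1%:R ^+ (2 * r + 1))^-1
  - 4 ^- r * \sum_(k < N %/ 2) (k.+1%:R ^+ (2 * r + 1))^-1 :> R.
Proof.
elim: N => [|N IH]; first by rewrite !big_ord0 mulr0 subrr.
rewrite !big_ord_recr/= IH !divn2.
case: (boolP (odd N)) => oN; last first.
  rewrite (_ : N.+1./2 = N./2); last by lia.
  rewrite -[(-1) ^+ N]signr_odd (negbTE oN) expr0 mul1r.
  by rewrite addrAC.
rewrite (_ : N.+1./2 = N./2.+1); last by lia.
rewrite big_ord_recr/= -[(-1) ^+ N]signr_odd oN expr1.
have -> : N.+1 = (2 * N./2.+1)%N by lia.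
have e2 : 2 ^+ (2 * r + 1) = 2 * 4 ^+ r :> R.
  by rewrite exprD exprM expr1 mulrC; congr (_ * _ ^+ _); ring.
rewrite natrM exprMn e2.
have k0 : N./2.+1%:R != 0 :> R by [].
have e4 : (4 ^+ r : R) != 0 by rewrite expf_neq0.
move: (N./2.+1%:R : R) k0 => x k0.
by field; rewrite e4 expf_neq0.
Qed.

Lemma zeta_partial_cvg s : (1 < s)%N ->
  \sum_(k < N) (k.+1%:R ^+ s)^-1 @[N --> \oo] --> riemann_zeta (s%:R : R).
Proof.
move=> s1; rewrite /riemann_zeta.
have e : series (riemannR (s%:R : R)) = fun N => \sum_(k < N) (k.+1%:R ^+ s)^-1.
  apply/funext => N; rewrite /series/= big_mkord; apply: eq_bigr => k _.
  by rewrite /riemannR powR_mulrn.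
(* [limn] is the actual limit once convergence is known: the partial sums increase and are bounded
   by 2. *)
rewrite -e; apply: nondecreasing_is_cvgn.
  rewrite e; apply/nondecreasing_seqP => N.
  by rewrite big_ord_recr/= lerDl invr_ge0 exprn_ge0.
exists 2 => _ [N _ <-]; rewrite e (le_trans _ (sum_inv_sqr_le N))//.
by apply: ler_sum => k _; exact: inv_pow_le.
Qed.

End StarSum.

Theorem theorem2p2 (R : realType) (r : nat) (hr : (0 < r)%N) :
  (fun N : nat => \sum_(1 <= n < N.+1)
     'C(2 * n, n)%:R / (n%:R * 4 ^+ n) * zeta_star R n (nseq_tuple r 2%N))
    @ \oo --> 2 * (1 - 4 ^- r) * riemann_zeta ((2 * r + 1)%:R : R).
Proof.
pose S N := \sum_(n < N) cbin R n.+1 0 / n.+1%:R * star2 R r n.+1.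
pose eta N : R := 2 * \sum_(k < N) (-1) ^+ k / k.+1%:R ^+ (2 * r + 1).
(* The difference tends to 0 by [sum_star2_eta], so [eta] alone determines the limit. *)
rewrite (_ : (fun N => _) = (S \- eta) \+ eta); last first.
  apply/funext => N; rewrite /= subrK big_add1 /= big_mkord; apply: eq_bigr => n _.
  by rewrite zeta_star_star2 /cbin addn0; congr (_ * _); rewrite invfM mulrA mulrAC.
rewrite -[X in _ --> X]add0r; apply: cvgD.
  apply/norm_cvg0P; apply: (squeeze_cvgr _ (cvg_cst 0)); last first.
    rewrite -(mulr0 (8 : R)); apply: cvgMr; exact: (@cbin0_cvg0 R).
  by near=> N; rewrite normr_ge0/= sum_star2_eta.
have z := @zeta_partial_cvg R (2 * r + 1) ltac:(lia).
(* The half-length sum in [eta_partial] also tends to zeta, as [N %/ 2] tends to infinity; this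
   yields the factor [1 - 4^-r]. *)
have z2 := cvg_comp _ _ (cvg_divnr 2 isT) z.
rewrite -mulrA; apply: cvgMr.
under eq_fun do rewrite eta_partial.
rewrite mulrBl mul1r; apply: cvgB; first exact: z.
apply: cvgMr; exact: z2.
Unshelve. all: by end_near. Qed.
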